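(* Let $G$ be an embedded graph and let $\vec{s}$ be a duality state of the embedded medial graph $G_m$. Then $((G_m)_{\vec{s}})_m$ and $G_m$ are equivalent as locally embedded maps; i.e. $$\mathrm{Orb}_{(\delta)}(G)=\{H\mid G_m \text{ and } H_m \text{ are equivalent as locally embedded maps}\},$$ where $H$ ranges over embedded graphs.
   Context: Embedded graphs. An embedded graph is a finite graph (loops and multiple edges allowed) cellularly embedded in a closed, possibly non-orientable, surface. Equivalently, it is a ribbon graph: a surface with boundary that is a union of vertex discs and edge discs, meeting in disjoint line segments, each segment on the boundary of exactly one vertex disc and one edge disc, each edge disc containing exactly two segments. Equivalently, it is an arrow presentation: a set of circles with disjoint labelled arrows on them, each label appearing on exactly two arrows, up to relabelling pairs and reversing both arrows of a given label. Circles correspond to vertex discs; for each label $e$ an edge disc is attached by orienting its boundary, choosing two disjoint boundary arcs directed accordingly, and identifying these with the two $e$-labelled arrows respecting directions. Embedded graphs are considered up to isomorphism (homeomorphism preserving the vertex-edge structure). Locally embedded maps. Choosing an orientation of a neighbourhood of each vertex of an embedded graph gives a cyclic order of the half-edges at each vertex, and so an underlying combinatorial map (abstract graph with cyclic orders of half-edges at vertices). Two embedded graphs are equivalent as locally embedded maps if the local orientations at their vertices can be chosen so that the resulting underlying combinatorial maps are equal (isomorphic). Partial duals. For an edge $e$ of $G$ (given as an arrow presentation), the dual with respect to $e$, $G^{\delta(e)}$, is obtained as follows: if $A,B$ are the two $e$-labelled arrows, add a segment with an $e$-labelled arrow directed from the head of $A$ to the tail of $B$, and a segment with an $e$-labelled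 arrow directed from the head of $B$ to the tail of $A$, and delete $A$ and $B$ together with the arcs containing them. For $A\subseteq E(G)$, $G^{\delta(A)}$ is the result of doing this at every edge in $A$ (the order is irrelevant). $\mathrm{Orb}_{(\delta)}(G)=\{G^{\delta(A)}\mid A\subseteq E(G)\}$ is the set of partial duals of $G$. Medial graphs. The medial graph $G_m$ of a cellularly embedded graph $G$ is the 4-regular embedded graph in the same surface with a vertex $v_e$ of degree 4 on each edge $e$ of $G$ and edges drawn by following the face boundaries of $G$. By convention an isolated vertex of $G$ gives an ''isolated face'' (a vertexless closed curve) in $G_m$, carried along as an arrowless circle in every graph state. Duality states. Let $F$ be a 4-regular embedded graph. A vertex state at $v$ is a choice of one of the three pairings of the four half-edges at $v$, where $v$ is replaced by two arcs joining the paired half-edges. An arrow marked vertex state is a vertex state with one $v$-labelled arrow on each of the two arcs. An arrow marked graph state $\vec{s}$ is a choice of arrow marked vertex state at each vertex; the resulting closed curves with arrows form an arrow presentation of an embedded graph $F_{\vec{s}}$. If the half-edges at $v$ are in cyclic order $h_1,h_2,h_3,h_4$, a split is one of the pairings $\{h_1h_2,h_3h_4\}$, $\{h_2h_3,h_4h_1\}$. A split is flat if its two arrows are both consistent with the same local orientation at $v$ (e.g. for $\{h_1h_2,h_3h_4\}$, directed from $h_1$ to $h_2$ and from $h_3$ to $h_4$, or both reversed). A duality state is an arrow marked graph state in which every vertex state is a flat split. *)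

(* Defs.v *)
From mathcomp Require Import all_boot.

Set Implicit Arguments.
Unset Strict Implicit.
Unset Printing Implicit Defensive.

(* Embedded graphs are treated as ribbon graphs.  A ribbon graph is recorded by
   its flags: the endpoints of the line segments
   in which vertex discs meet edge discs.  A flag [x] lies on the boundary of
   one vertex disc and of one edge disc, and
     - [seg x] is the other endpoint of the line segment containing [x];
     - [side x] is the other end of the arc of the boundary of the edge disc
       that starts at [x] and is not a segment;
     - [arc x] is the other end of the arc of the boundary of the vertex disc
       that starts at [x] and is not a segment.
   The axioms on [seg] and [side] say that the boundary of an edge disc
   contains exactly two segments.  Vertex discs meeting no edge disc carry no
   flag and are counted by [isolated].  Loops, multiple edges, disconnected and
   non-orientable ribbon graphs are all allowed. *)
Record ribbon_graph := RibbonGraph {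
  flag : finType;
  seg : flag -> flag;
  side : flag -> flag;
  arc : flag -> flag;
  isolated : nat;
  segK : involutive seg;
  sideK : involutive side;
  arcK : involutive arc;
  seg_neq : forall x, seg x != x;
  side_neq : forall x, side x != x;
  arc_neq : forall x, arc x != x;
  seg_side : forall x, seg (side x) = side (seg x);
  seg_side_neq : forall x, seg (side x) != x
}.

Definition ribbon_iso (G H : ribbon_graph) : Prop :=
  isolated G = isolated H /\
  exists f : flag G -> flag H,
    [/\ bijective f,
        forall x, f (seg x) = seg (f x),
        forall x, f (side x) = side (f x)
      & forall x, f (arc x) = arc (f x)].

(* A half-edge is an end of an edge disc, i.e. a segment, identified with the
   set of its two endpoints.  A (non-isolated) vertex is identified with the
   set of flags on the boundary of its disc. *)

Definition segment (G : ribbon_graph) (x : flag G) : {set flag G} :=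
  [set x; seg x].

Definition half_edge (G : ribbon_graph) : predArgType :=
  {h : {set flag G} | [exists x, h == segment x]}.

Definition boundary_step (G : ribbon_graph) : rel (flag G) :=
  fun x y => (y == seg x) || (y == arc x).

Definition vertex_flags (G : ribbon_graph) (x : flag G) : {set flag G} :=
  [set y | connect (@boundary_step G) x y].

Definition vertex (G : ribbon_graph) : predArgType :=
  {v : {set flag G} | [exists x, v == vertex_flags x]}.

Definition incident (G : ribbon_graph) (h : half_edge G) (v : vertex G) : bool :=
  val h \subset val v.

Definition degree (G : ribbon_graph) (v : vertex G) : nat :=
  #|[set h : half_edge G | incident h v]|.

Lemma half_edge_subproof (G : ribbon_graph) (x : flag G) :
  [exists y, segment x == segment y].
Proof. by apply/existsP; exists x. Qed.

Definition he (G : ribbon_graph) (x : flag G) : half_edge G :=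
  exist _ (segment x) (half_edge_subproof x).

Lemma vertex_subproof (G : ribbon_graph) (x : flag G) :
  [exists y, vertex_flags x == vertex_flags y].
Proof. by apply/existsP; exists x. Qed.

Definition vtx (G : ribbon_graph) (x : flag G) : vertex G :=
  exist _ (vertex_flags x) (vertex_subproof x).

Lemma heP (G : ribbon_graph) (h : half_edge G) : exists x, h = he x.
Proof.
by case: (existsP (valP h)) => x /eqP hx; exists x; apply: val_inj.
Qed.

Lemma vtxP (G : ribbon_graph) (v : vertex G) : exists x, v = vtx x.
Proof.
by case: (existsP (valP v)) => x /eqP vx; exists x; apply: val_inj.
Qed.

Lemma segment_seg (G : ribbon_graph) (x : flag G) : segment (seg x) = segment x.
Proof. by rewrite /segment segK setUC. Qed.

Lemma he_eq (G : ribbon_graph) (x y : flag G) :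
  (he x == he y) = (y == x) || (y == seg x).
Proof.
apply/eqP/idP => [/(congr1 val)/= e|/orP[]/eqP->//].
  by have := set21 y (seg y); rewrite -[[set _; _]]e !inE.
by apply: val_inj; rewrite /= segment_seg.
Qed.

Lemma he_seg (G : ribbon_graph) (x : flag G) : he (seg x) = he x.
Proof. by apply: val_inj; rewrite /= segment_seg. Qed.

Lemma opp_subproof (G : ribbon_graph) (h : half_edge G) :
  [exists x, @side G @: val h == segment x].
Proof.
have [x ->] := heP h; apply/existsP; exists (side x); apply/eqP.
by rewrite /= /segment imsetU !imset_set1 seg_side.
Qed.

(* The half-edge at the other end of the same edge. *)
Definition opp (G : ribbon_graph) (h : half_edge G) : half_edge G :=
  exist _ (@side G @: val h) (opp_subproof h).

Lemma opp_he (G : ribbon_graph) (x : flag G) : opp (he x) = he (side x).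
Proof.
by apply: val_inj; rewrite /= /segment imsetU !imset_set1 seg_side.
Qed.

Lemma oppK (G : ribbon_graph) : involutive (@opp G).
Proof. by move=> h; have [x ->] := heP h; rewrite !opp_he sideK. Qed.

Lemma opp_neq (G : ribbon_graph) (h : half_edge G) : opp h != h.
Proof.
have [x ->] := heP h; rewrite opp_he he_eq negb_or eq_sym side_neq /=.
by rewrite eq_sym seg_side_neq.
Qed.

(* The boundary of a non-isolated vertex disc alternates between segments and
   free arcs.  Orienting it amounts to selecting the flags at which the
   oriented boundary enters a segment ([true]) rather than leaves it; this is
   done independently at every vertex. *)
Record local_orientation (G : ribbon_graph) := LocalOrientation {
  enters :> flag G -> bool;
  enters_seg : forall x, enters (seg x) = ~~ enters x;
  enters_arc : forall x, enters (arc x) = ~~ enters x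
}.

Lemma entry_ex (G : ribbon_graph) (o : local_orientation G) (h : half_edge G) :
  exists x, (x \in val h) && o x.
Proof.
have [x ->] := heP h; case ox: (o x).
  by exists x; rewrite /= set21.
by exists (seg x); rewrite /= set22 enters_seg ox.
Qed.

Definition entry (G : ribbon_graph) (o : local_orientation G)
  (h : half_edge G) : flag G := xchoose (entry_ex o h).

(* The half-edge following [h] in the cyclic order determined by [o]. *)
Definition rot_next (G : ribbon_graph) (o : local_orientation G)
  (h : half_edge G) : half_edge G := he (arc (seg (entry o h))).

Lemma rot_next_he (G : ribbon_graph) (o : local_orientation G) (x : flag G) :
  o x -> rot_next o (he x) = he (arc (seg x)).
Proof.
move=> ox; rewrite /rot_next; congr (he (arc (seg _))).
have /andP[] := xchooseP (entry_ex o (he x)); rewrite -/(entry _ _).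
by rewrite /= !inE => /orP[]/eqP-> //; rewrite enters_seg ox.
Qed.

Lemma rot_next_inj (G : ribbon_graph) (o : local_orientation G) :
  injective (rot_next o).
Proof.
have ex (h : half_edge G) : exists2 x, h = he x & o x.
  have [x ->] := heP h; case ox: (o x); first by exists x.
  by exists (seg x); rewrite ?he_seg ?enters_seg ?ox.
move=> h1 h2; have [x -> ox] := ex h1; have [y -> oy] := ex h2.
rewrite !rot_next_he // => /eqP; rewrite he_eq => /orP[]/eqP e.
  by move: (can_inj (@arcK G) e) => /(can_inj (@segK G)) ->.
by move: (congr1 o e); rewrite !(enters_arc, enters_seg) ox oy.
Qed.

(* A combinatorial map: the vertices are the cycles of [cm_rot], the edges are
   the orbits of [cm_opp], and isolated vertices are counted separately. *)
Record comb_map := CombMap {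
  cm_half : finType;
  cm_rot : cm_half -> cm_half;
  cm_opp : cm_half -> cm_half;
  cm_isolated : nat;
  cm_rot_inj : injective cm_rot;
  cm_oppK : involutive cm_opp;
  cm_opp_neq : forall h, cm_opp h != h
}.

Definition comb_map_iso (M N : comb_map) : Prop :=
  cm_isolated M = cm_isolated N /\
  exists f : cm_half M -> cm_half N,
    [/\ bijective f,
        forall h, f (cm_rot h) = cm_rot (f h)
      & forall h, f (cm_opp h) = cm_opp (f h)].

Definition underlying_map (G : ribbon_graph) (o : local_orientation G) :
    comb_map :=
  CombMap (isolated G) (@rot_next_inj G o) (@oppK G) (@opp_neq G).

Definition ribbon_loc_equiv (G H : ribbon_graph) : Prop :=
  exists (o : local_orientation G) (o' : local_orientation H),
    comb_map_iso (underlying_map o) (underlying_map o').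

Definition four_regular (G : ribbon_graph) : Prop :=
  isolated G = 0 /\ forall v : vertex G, degree v = 4.

(* 4-regular embedded graphs may have vertexless closed curves ("isolated
   faces"); [free_curves] counts them. *)
Record graph4 := Graph4 {
  skeleton :> ribbon_graph;
  free_curves : nat;
  skeleton_regular : four_regular skeleton
}.

Definition loc_equiv (F F' : graph4) : Prop :=
  free_curves F = free_curves F' /\ ribbon_loc_equiv F F'.

Section Medial.

Variable G : ribbon_graph.

(* Draw [v_e] at the centre of the edge disc of [e], join it inside that disc
   to the four flags [x] of [e], and continue past [x] along the free arc of
   the vertex disc from [x] to [arc x].  So the half-edges of the medial graph
   correspond to the flags [x] of [G], and the two flags of a half-edge are
   [(x, true)], on the side of the vertices of [G], and [(x, false)], on the
   side of the faces of [G].  Around [v_e], the half-edges towards [x] and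
   [seg x] bound a corner containing a piece of a vertex disc of [G], those
   towards [x] and [side x] one containing a piece of a face of [G]. *)
Let mflag : finType := (flag G * bool)%type.
Definition med_seg (z : mflag) : mflag := (z.1, ~~ z.2).
Definition med_side (z : mflag) : mflag := (arc z.1, z.2).
Definition med_arc (z : mflag) : mflag :=
  (if z.2 then seg z.1 else side z.1, z.2).

Lemma med_segK : involutive med_seg.
Proof. by case=> x s; rewrite /med_seg /= negbK. Qed.
Lemma med_sideK : involutive med_side.
Proof. by case=> x s; rewrite /med_side /= arcK. Qed.
Lemma med_arcK : involutive med_arc.
Proof. by case=> x []; rewrite /med_arc /= ?segK ?sideK. Qed.
Lemma med_seg_neq z : med_seg z != z.
Proof. by case: z => x []; rewrite xpair_eqE andbF. Qed.
Lemma med_side_neq z : med_side z != z.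
Proof. by case: z => x s; rewrite xpair_eqE (negbTE (arc_neq x)). Qed.
Lemma med_arc_neq z : med_arc z != z.
Proof.
by case: z => x []; rewrite xpair_eqE ?(negbTE (seg_neq x)) ?(negbTE (side_neq x)).
Qed.
Lemma med_seg_side z : med_seg (med_side z) = med_side (med_seg z).
Proof. by []. Qed.
Lemma med_seg_side_neq z : med_seg (med_side z) != z.
Proof. by case: z => x s; rewrite xpair_eqE (negbTE (arc_neq x)). Qed.

Definition medial_ribbon : ribbon_graph :=
  RibbonGraph 0 med_segK med_sideK med_arcK
    med_seg_neq med_side_neq med_arc_neq med_seg_side med_seg_side_neq.

Lemma medial_vertex_flags (x : flag G) (s : bool) :
  @vertex_flags medial_ribbon (x, s) =
  [set z | z.1 \in [:: x; seg x; side x; seg (side x)]].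
Proof.
set c := [:: _; _; _; _].
have cseg y : y \in c -> seg y \in c.
  by rewrite !inE => /or4P[]/eqP->; rewrite ?segK eqxx ?orbT.
have cside y : y \in c -> side y \in c.
  by rewrite !inE => /or4P[]/eqP->; rewrite -?seg_side ?sideK eqxx ?orbT.
apply/setP=> z; rewrite [LHS]in_set [RHS]in_set; apply/idP/idP.
  case/connectP=> p; have: (x, s).1 \in c by rewrite !inE eqxx.
  elim: p (x, s) => [|y p IHp] w wc; first by move=> _ ->.
  rewrite [path _ _ _]/= [last _ _]/= => /andP[wy yp] zl; apply: (IHp y) => //.
  case/orP: wy => /eqP-> //=.
  by case: w.2; [apply: cseg|apply: cside].
have flip y a b : connect (@boundary_step medial_ribbon) (y, a) (y, b).
  case: (a =P b) => [->|/eqP nab]; first exact: connect0.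
  apply: connect1; apply/orP; left; rewrite xpair_eqE eqxx /=.
  by case: a b nab => [] [].
have toseg y a b : connect (@boundary_step medial_ribbon) (y, a) (seg y, b).
  apply: connect_trans (flip y a true) (connect_trans _ (flip _ true b)).
  by apply: connect1; apply/orP; right.
have toside y a b : connect (@boundary_step medial_ribbon) (y, a) (side y, b).
  apply: connect_trans (flip y a false) (connect_trans _ (flip _ false b)).
  by apply: connect1; apply/orP; right.
case: z => y b /=; rewrite !inE => /or4P[]/eqP-> //.
exact: connect_trans (toside _ _ true) (toseg _ _ _).
Qed.

Lemma medial_four_regular : four_regular medial_ribbon.
Proof.
split=> // v; have [[x s] ->] := vtxP v; rewrite /degree.
set c := [:: x; seg x; side x; seg (side x)].
have uc : uniq c.
  have nss : seg x != side x.
    by apply/eqP=> e; have := seg_side_neq x; rewrite -e segK eqxx.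
  rewrite /= !inE !negb_or !andbT nss (can_eq (@segK G)) ![x == _]eq_sym.
  by rewrite [side x == seg _]eq_sym !seg_neq !side_neq seg_side_neq.
pose g (y : flag G) : half_edge medial_ribbon := he ((y, true) : flag medial_ribbon).
have ginj : injective g.
  by move=> y y' /eqP; rewrite he_eq !xpair_eqE andbT andbF orbF => /eqP.
suff -> : [set h | incident h (@vtx medial_ribbon (x, s))] = g @: [set y in c].
  by rewrite card_imset // cardsE (card_uniqP uc).
apply/setP=> h; rewrite inE /incident /= medial_vertex_flags -/c.
have [[y b] ->] := heP h.
have -> : he ((y, b) : flag medial_ribbon) = g y.
  by case: b => //; rewrite /g -he_seg.
rewrite (mem_imset _ _ ginj) inE; apply/subsetP/idP => [/(_ (y, true))|yc z].
  by rewrite /= !inE eqxx; apply.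
by rewrite /= !in_set !in_set1 => /orP[]/eqP->.
Qed.

Definition medial : graph4 := Graph4 (isolated G) medial_four_regular.

End Medial.

(* The two arrows labelled [e] are [(e, false)] and [(e, true)], with ends
   [(e, b, arrow_tail)] and [(e, b, arrow_head)]; on the circles, the end [z] is followed
   outside the arrows by the arc joining it to the end [parc z].  The circles
   carrying arrows are thus determined by [parc], and those carrying none are
   counted by [arrowless]. *)
Notation arrow_end L := (L * bool * bool)%type.
Definition arrow_tail := false.
Definition arrow_head := true.

Record arrow_pres := ArrowPres {
  label : finType;
  parc : arrow_end label -> arrow_end label;
  arrowless : nat;
  parcK : involutive parc;
  parc_neq : forall z, parc z != z
}.

Section RibbonOf.

Variable P : arrow_pres.

(* The oriented boundary of the edge disc of [e] runs along one [e]-labelled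
   arrow, then from its head to the tail of the other one, along this arrow,
   and from its head back to the tail of the first. *)
Definition pres_seg (z : arrow_end (label P)) := (z.1, ~~ z.2).
Definition pres_side (z : arrow_end (label P)) := (z.1.1, ~~ z.1.2, ~~ z.2).

Lemma pres_segK : involutive pres_seg.
Proof. by case=> [[e b] t]; rewrite /pres_seg /= negbK. Qed.
Lemma pres_sideK : involutive pres_side.
Proof. by case=> [[e b] t]; rewrite /pres_side /= !negbK. Qed.
Lemma pres_seg_neq z : pres_seg z != z.
Proof. by case: z => [[e b] []]; rewrite xpair_eqE andbF. Qed.
Lemma pres_side_neq z : pres_side z != z.
Proof. by case: z => [[e b] []]; rewrite xpair_eqE andbF. Qed.
Lemma pres_seg_side z : pres_seg (pres_side z) = pres_side (pres_seg z).
Proof. by []. Qed.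
Lemma pres_seg_side_neq z : pres_seg (pres_side z) != z.
Proof. by case: z => [[e []] t]; rewrite !xpair_eqE ?andbF. Qed.

Definition ribbon_of : ribbon_graph :=
  RibbonGraph (arrowless P) pres_segK pres_sideK (@parcK P)
    pres_seg_neq pres_side_neq (@parc_neq P) pres_seg_side pres_seg_side_neq.

End RibbonOf.

Definition presents (P : arrow_pres) (G : ribbon_graph) : Prop :=
  ribbon_iso (ribbon_of P) G.

Section PartialDual.

Variables (P : arrow_pres) (A : {set label P}).

(* For [e] in [A], the new [e]-labelled arrows go from the head of each old
   [e]-labelled arrow to the tail of the other one: [old_end z] is the old
   arrow end situated at the new arrow end [z]. *)
Definition old_end (z : arrow_end (label P)) : arrow_end (label P) :=
  let: (e, b, t) := z in
  if e \in A then (if t == arrow_tail then (e, b, arrow_head) else (e, ~~ b, arrow_tail)) else z.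

Definition new_end (z : arrow_end (label P)) : arrow_end (label P) :=
  let: (e, b, t) := z in
  if e \in A then (if t == arrow_head then (e, b, arrow_tail) else (e, ~~ b, arrow_head)) else z.

Lemma old_endK : cancel old_end new_end.
Proof.
case=> [[e b] t]; rewrite /old_end; case eA: (e \in A); last by rewrite /new_end eA.
by case: t; rewrite /new_end /= eA ?negbK.
Qed.

Lemma new_endK : cancel new_end old_end.
Proof.
case=> [[e b] t]; rewrite /new_end; case eA: (e \in A); last by rewrite /old_end eA.
by case: t; rewrite /old_end /= eA ?negbK.
Qed.

Definition dual_parc (z : arrow_end (label P)) := new_end (parc (old_end z)).

Lemma dual_parcK : involutive dual_parc.
Proof. by move=> z; rewrite /dual_parc new_endK parcK old_endK. Qed.

Lemma dual_parc_neq z : dual_parc z != z.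
Proof. by rewrite -(can_eq old_endK) new_endK parc_neq. Qed.

Definition partial_dual : arrow_pres :=
  ArrowPres (arrowless P) dual_parcK dual_parc_neq.

End PartialDual.

Definition partial_dual_orbit (G H : ribbon_graph) : Prop :=
  exists (P : arrow_pres) (A : {set label P}),
    presents P G /\ presents (partial_dual A) H.

(* At each vertex [v], the two arcs of the vertex state are numbered by
   booleans, and the arrow on the arc [b] is directed from the half-edge
   [mark (v, b, arrow_tail)] to the half-edge [mark (v, b, arrow_head)].  So the pairing
   chosen at [v] is that of [mark (v, b, arrow_tail)] with [mark (v, b, arrow_head)]. *)
Record marked_state (F : graph4) := MarkedState {
  mark : arrow_end (vertex F) -> half_edge F;
  unmark : half_edge F -> arrow_end (vertex F);
  markK : cancel mark unmark;
  unmarkK : cancel unmark mark;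
  mark_incident : forall z, incident (mark z) z.1.1
}.

Section StatePres.

Variables (F : graph4) (s : marked_state F).

(* Outside the arrows, the curves of the state follow the edges of [F]. *)
Definition state_parc (z : arrow_end (vertex F)) := unmark s (opp (mark s z)).

Lemma state_parcK : involutive state_parc.
Proof. by move=> z; rewrite /state_parc unmarkK oppK markK. Qed.

Lemma state_parc_neq z : state_parc z != z.
Proof. by rewrite -(can_eq (markK s)) unmarkK opp_neq. Qed.

Definition state_pres : arrow_pres :=
  ArrowPres (free_curves F) state_parcK state_parc_neq.

Definition flat_split (v : vertex F) : Prop :=
  exists o : local_orientation F,
    forall b, rot_next o (mark s (v, b, arrow_tail)) = mark s (v, b, arrow_head).

Definition duality_state : Prop := forall v, flat_split v.

End StatePres.

(* Main.v *)
From mathcomp Require Import all_boot.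
Require Import Defs.

Set Implicit Arguments.
Unset Strict Implicit.
Unset Printing Implicit Defensive.

(** Locally, the medial graph of [G] forgets which corners at the medial vertex
   [v_e] contain vertices of [G] and which contain faces of [G].  Its half-edges
   are the flags of [G]; going along a medial edge is [arc], and the cyclic order
   at [v_e], once the edge disc of [e] is oriented, is a quarter turn of the four
   flags of [e], which applies [seg] and [side] alternately
   ([loc_equiv_medialP]).

   In an arrow presentation, orient every edge disc so that the quarter turn
   leads each tail along its arrow, and each head to the tail of the other arrow.
   Dualising at [e] replaces the ends of the [e]-labelled arrows by their images
   under this very quarter turn ([old_endE]).  Since a permutation commutes
   with its powers, partial dualisation changes neither the quarter turns nor, up
   to relabelling, the arcs, so medial graphs of partial duals are locally
   equivalent.

   Conversely, let [f] be a local equivalence between the medial graphs of [G]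
   and [H].  It preserves the quarter turns; so on each edge it either respects
   [seg] and [side], or exchanges them, according to whether it maps the
   places where the turn of [G] is along [seg] to places where the turn of [H]
   is along [seg] or along [side].  Composing [f] with a quarter turn at the
   edges of the second kind makes it respect [seg] and [side] everywhere
   ([turn_preserving_iso]), which exhibits [H] as the partial dual of [G] at
   these edges.

   Finally, a flat split at [v_e] joins each arrow tail to the next half-edge
   around [v_e].  The four half-edges at [v_e] being exhausted by the two arrows,
   each head is then followed by the tail of the other arrow
   ([half_turn_mem]).  Hence [mark] carries the quarter turn of the presentation
   to the rotation of [G_m], which is the first assertion. *)

(** * Quarter turns of edge discs *)

Section QuarterTurn.

Variable G : ribbon_graph.

(** An orientation of every edge disc, given by the flags at which the oriented
   boundary of the disc leaves a segment and enters a free arc. *)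
Definition edge_orientation (e : flag G -> bool) : Prop :=
  (forall x, e (seg x) = ~~ e x) /\ (forall x, e (side x) = ~~ e x).

Definition quarter_turn (e : flag G -> bool) (x : flag G) : flag G :=
  if e x then side x else seg x.

Variable e : flag G -> bool.
Hypothesis eP : edge_orientation e.

Lemma edge_orientation_turn x : e (quarter_turn e x) = ~~ e x.
Proof. by rewrite /quarter_turn; case: ifP => ex; rewrite ?eP.1 ?eP.2 ex. Qed.

Lemma half_turnE x : quarter_turn e (quarter_turn e x) = seg (side x).
Proof.
rewrite {1}/quarter_turn edge_orientation_turn /quarter_turn.
by case: (e x); rewrite /= ?seg_side.
Qed.

Lemma quarter_turn4 x :
  quarter_turn e (quarter_turn e (quarter_turn e (quarter_turn e x))) = x.
Proof. by rewrite !half_turnE -seg_side segK sideK. Qed.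

Lemma quarter_turn_inj : injective (quarter_turn e).
Proof.
by move=> x y /(congr1 (iter 3 (quarter_turn e))) /=; rewrite !quarter_turn4.
Qed.

Lemma quarter_turn_seg x :
  seg x = if e x then iter 3 (quarter_turn e) x else quarter_turn e x.
Proof.
case ex: (e x); last by rewrite /quarter_turn ex.
by apply: quarter_turn_inj; rewrite /= quarter_turn4 /quarter_turn eP.1 ex segK.
Qed.

Lemma quarter_turn_side x :
  side x = if e x then quarter_turn e x else iter 3 (quarter_turn e) x.
Proof.
case ex: (e x); first by rewrite /quarter_turn ex.
by apply: quarter_turn_inj; rewrite /= quarter_turn4 /quarter_turn eP.2 ex sideK.
Qed.

(** Two disjoint arcs [x, T x] and [y, T y] of the same four-cycle of
   the quarter turn [T] start half a turn apart. *)
Lemma half_turn_mem x y :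
    y \in [:: x; seg x; side x; seg (side x)] ->
    y != x -> y != quarter_turn e x -> quarter_turn e y != x ->
  quarter_turn e (quarter_turn e x) = y.
Proof.
move=> yx nyx nyTx nTyx; apply/eqP; rewrite half_turnE.
move: yx nyTx nTyx; rewrite !inE (negbTE nyx) /=.
case/or3P => /eqP->; last by [].
  by rewrite quarter_turn_seg; case: ifP => _ /=; rewrite ?quarter_turn4 eqxx.
by rewrite quarter_turn_side; case: ifP => _ /=; rewrite ?quarter_turn4 eqxx.
Qed.

End QuarterTurn.

(** The quarter turn together with the places where it is along [seg]
   determines [seg] and [side], by [quarter_turn_seg] and [quarter_turn_side]. *)
Lemma turn_preserving_iso (G H : ribbon_graph) (e : flag G -> bool)
    (e' : flag H -> bool) (f : flag G -> flag H) :
    edge_orientation e -> edge_orientation e' ->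
    (forall x, f (quarter_turn e x) = quarter_turn e' (f x)) ->
    (forall x, e' (f x) = e x) ->
  (forall x, f (seg x) = seg (f x)) /\ (forall x, f (side x) = side (f x)).
Proof.
move=> eP e'P fT fe; split=> x.
  rewrite (quarter_turn_seg eP) (quarter_turn_seg e'P) fe.
  by case: ifP => _; rewrite /= !fT.
rewrite (quarter_turn_side eP) (quarter_turn_side e'P) fe.
by case: ifP => _; rewrite /= !fT.
Qed.

Lemma iso_quarter_turn (G H : ribbon_graph) (f : flag G -> flag H)
    (g : flag H -> flag G) (e : flag G -> bool) :
    cancel f g -> cancel g f ->
    (forall x, f (seg x) = seg (f x)) -> (forall x, f (side x) = side (f x)) ->
    edge_orientation e ->
  edge_orientation (e \o g) /\
  forall x, f (quarter_turn e x) = quarter_turn (e \o g) (f x).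
Proof.
move=> fK gK fseg fside [es ed]; split; last first.
  by move=> x; rewrite /quarter_turn /= fK; case: ifP.
by split=> y /=; rewrite -{1}(gK y) -?fseg -?fside fK.
Qed.

(** * The local structure of the medial graph *)

Section MedialMap.

Variable G : ribbon_graph.

Definition medial_half (x : flag G) : half_edge (medial G) :=
  he ((x, true) : flag (medial G)).

Lemma he_medial (x : flag G) b :
  he ((x, b) : flag (medial G)) = medial_half x.
Proof. by case: b => //; rewrite /medial_half -he_seg. Qed.

Lemma medial_half_bij : bijective medial_half.
Proof.
have inj : injective medial_half.
  by move=> x y /eqP; rewrite he_eq !xpair_eqE andbT andbF orbF => /eqP.
have sur h : exists x, medial_half x == h.
  by have [[x b] ->] := heP h; exists x; rewrite he_medial.
exists (fun h => xchoose (sur h)) => [x|h]; last exact/eqP/(xchooseP (sur h)).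
exact/inj/eqP/(xchooseP (sur _)).
Qed.

Lemma opp_medial_half (x : flag G) : opp (medial_half x) = medial_half (arc x).
Proof. exact: opp_he. Qed.

Lemma edge_orientation_medial (o : local_orientation (medial G)) :
  edge_orientation (fun x => o (x, true)).
Proof.
split=> x; first exact: (enters_arc o (x, true)).
rewrite (enters_seg o (side x, false)) (enters_arc o (x, false)) negbK.
exact: (enters_seg o (x, true)).
Qed.

Lemma rot_medial_half (o : local_orientation (medial G)) (x : flag G) :
  rot_next o (medial_half x) =
  medial_half (quarter_turn (fun x => o (x, true)) x).
Proof.
rewrite /quarter_turn; case ox: (o (x, true)).
  by rewrite rot_next_he //= he_medial.
by rewrite -(he_medial x false) rot_next_he // (enters_seg o (x, true)) ox.
Qed.

Lemma medial_orientation_ex (e : flag G -> bool) :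
  edge_orientation e ->
  exists o : local_orientation (medial G), forall x : flag G, o (x, true) = e x.
Proof.
case=> es ed; pose o (z : flag (medial G)) := e z.1 == z.2.
have oseg z : o (seg z) = ~~ o z by case: z => x []; rewrite /o /=; case: (e x).
have oarc z : o (arc z) = ~~ o z.
  by case: z => x []; rewrite /o /= ?es ?ed; case: (e x).
by exists (LocalOrientation oseg oarc) => x; rewrite /= /o /= eqb_id.
Qed.

Lemma incident_medial_half (x : flag G) (v : vertex (medial G)) :
  incident (medial_half x) v ->
  v = @vtx (medial G) (x, true).
Proof.
have [[w b] ->] := vtxP v; rewrite /incident /= medial_vertex_flags.
move=> /subsetP/(_ (x, true)); rewrite set21 inE => /(_ isT) xw.
apply: val_inj; rewrite /= !medial_vertex_flags; apply/setP=> z.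
rewrite [LHS]in_set [RHS]in_set; move: xw => /=; rewrite !inE.
by case/or4P=> /eqP->; rewrite !(seg_side, segK, sideK); do 4!case: (_ == _).
Qed.

Lemma incident_medial_halfE (x y : flag G) :
  incident (medial_half y) (@vtx (medial G) (x, true)) =
  (y \in [:: x; seg x; side x; seg (side x)]).
Proof.
rewrite /incident /= medial_vertex_flags.
apply/subsetP/idP => [/(_ (y, true))|yx z]; last first.
  by rewrite /= !in_set !in_set1 => /orP[]/eqP->.
by rewrite set21 inE => /(_ isT).
Qed.

End MedialMap.

(** An orientation at [v_e] is the same as an orientation of the edge disc of [e],
   and the rotation that it induces is the quarter turn of that disc. *)
Lemma loc_equiv_medialP (G H : ribbon_graph) :
  loc_equiv (medial G) (medial H) <->
  isolated G = isolated H /\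
  exists (e : flag G -> bool) (e' : flag H -> bool) (f : flag G -> flag H),
    [/\ edge_orientation e /\ edge_orientation e', bijective f,
        forall x, f (quarter_turn e x) = quarter_turn e' (f x)
      & forall x, f (arc x) = arc (f x)].
Proof.
have [gG gGK GgK] := medial_half_bij G; have [gH gHK HgK] := medial_half_bij H.
have bijG : bijective gG by exists (@medial_half G).
have bijH : bijective gH by exists (@medial_half H).
split=> [[iso [o [o' [_ [f [fbij frot fopp]]]]]]|].
  split=> //; exists (fun x => o (x, true)), (fun x => o' (x, true)).
  exists (gH \o f \o @medial_half G).
  split=> [||x|x]; first by split; apply: edge_orientation_medial.
  - exact: bij_comp (bij_comp bijH fbij) (medial_half_bij G).
  - apply: (can_inj gHK); rewrite -rot_medial_half /= !HgK -rot_medial_half.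
    exact: frot.
  - apply: (can_inj gHK); rewrite -opp_medial_half /= !HgK -opp_medial_half.
    exact: fopp.
case=> iso [e [e' [f [[eP e'P] fbij fT farc]]]]; split=> //.
have [o oE] := medial_orientation_ex eP.
have [o' o'E] := medial_orientation_ex e'P.
have tE x : quarter_turn (fun x => o (x, true)) x = quarter_turn e x.
  by rewrite /quarter_turn oE.
have tE' x : quarter_turn (fun x => o' (x, true)) x = quarter_turn e' x.
  by rewrite /quarter_turn o'E.
exists o, o'; split=> //; exists (@medial_half H \o f \o gG).
split=> [|h|h]; first exact: bij_comp (bij_comp (medial_half_bij H) fbij) bijG.
- by rewrite -(GgK h) /= !rot_medial_half !gGK tE fT tE'.
- by rewrite -(GgK h) /= !opp_medial_half !gGK farc.
Qed.

(** * Arrow presentations and partial duals *)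

Definition at_head (P : arrow_pres) (z : flag (ribbon_of P)) : bool :=
  z.2 == arrow_head.

Lemma at_head_orientation (P : arrow_pres) : edge_orientation (@at_head P).
Proof. by split; case=> [[l b] []]. Qed.

Lemma arrow_turnE (P : arrow_pres) (l : label P) (b t : bool) :
  quarter_turn (@at_head P) ((l, b, t) : flag (ribbon_of P)) = (l, b (+) t, ~~ t).
Proof. by case: b t => [] []. Qed.

(** Partial dualisation is a quarter turn of the chosen edge discs. *)
Lemma old_endE (P : arrow_pres) (A : {set label P}) (z : flag (ribbon_of P)) :
  old_end A z = if z.1.1 \in A then quarter_turn (@at_head P) z else z.
Proof.
by case: z => [[l b] t]; rewrite arrow_turnE /=; case: (l \in A) b t => [] [] [].
Qed.

(** Dualising turns the four arrow ends of an edge simultaneously, and so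
   commutes with their quarter turn. *)
Lemma old_end_turn (P : arrow_pres) (A : {set label P})
    (z : flag (ribbon_of (partial_dual A))) :
  old_end A (quarter_turn (@at_head (partial_dual A)) z) =
  quarter_turn (@at_head P) (old_end A z).
Proof.
case: z => [[l b] t]; rewrite (@arrow_turnE (partial_dual A)) !(@old_endE P A) /=.
by case: (l \in A); rewrite !(@arrow_turnE P).
Qed.

(** The orientation makes two flags of each edge eligible as arrow tails; they
   are exchanged by [seg \o side], and the first of them in a fixed enumeration
   serves as the label.  Freedom in the choice of the orientation is what allows a
   presentation of [G] to be adapted to a local equivalence of medial graphs. *)
Lemma oriented_presentation (G : ribbon_graph) (e : flag G -> bool) :
  edge_orientation e ->
  exists (P : arrow_pres) (g : flag (ribbon_of P) -> flag G),
    [/\ isolated (ribbon_of P) = isolated G, bijective g,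
        forall z, g (arc z) = arc (g z),
        forall z, g (quarter_turn (@at_head P) z) = quarter_turn e (g z)
      & forall z, e (g z) = at_head z].
Proof.
move=> eP; pose anti (x : flag G) := seg (side x).
have antiK : involutive anti.
  by move=> x; rewrite /anti seg_side segK sideK.
have eanti x : e (anti x) = e x by rewrite /anti eP.1 eP.2 negbK.
pose first_tail x := ~~ e x && (enum_rank x < enum_rank (anti x)).
pose L : finType := {x | first_tail x}.
pose g (z : arrow_end L) : flag G :=
  let y := if z.1.2 then anti (val z.1.1) else val z.1.1 in
  if z.2 then seg y else y.
have eg z : e (g z) = z.2.
  case: z => [[[x xP] b] t]; rewrite /g /=; have /andP[/negbTE ex _] := xP.
  have eb : e (if b then anti x else x) = false by case: b; rewrite ?eanti.
  by case: t; rewrite ?eP.1 eb.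
have ginj : injective g.
  move=> z1 z2 g12; have t12: z1.2 = z2.2 by rewrite -!eg g12.
  case: z1 z2 g12 t12 => [[x1 b1] t1] [[x2 b2] t2] /= g12 t12.
  rewrite -{}t12 {t2} in g12 *.
  have {}g12: (if b1 then anti (val x1) else val x1) =
              (if b2 then anti (val x2) else val x2).
    by move: g12; rewrite /g /=; case: t1 => // /(can_inj (@segK G)).
  have clash y z : first_tail y -> first_tail z -> y = anti z -> False.
    case/andP=> _ + /andP[_ +] yz; rewrite yz antiK => yz1 zy1.
    by have := ltn_trans yz1 zy1; rewrite ltnn.
  case: b1 b2 g12 => [] [] g12.
  - by rewrite (val_inj (can_inj antiK g12)).
  - by case: (clash _ _ (valP x2) (valP x1)).
  - by case: (clash _ _ (valP x1) (valP x2)).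
  - by rewrite (val_inj g12).
have gtail y : e y = false -> exists l b, g (l, b, false) = y.
  move=> ey; case: (ltngtP (enum_rank y) (enum_rank (anti y))) => r.
  - have yP : first_tail y by rewrite /first_tail ey r.
    by exists (exist _ y yP), false.
  - have yP : first_tail (anti y) by rewrite /first_tail eanti ey antiK r.
    by exists (exist _ (anti y) yP), true; rewrite /g /= antiK.
  - have /enum_rank_inj/eqP := val_inj r.
    by rewrite eq_sym (negbTE (seg_side_neq y)).
have gsur y : exists z, g z == y.
  case ey: (e y); last by have [l [b <-]] := gtail y ey; exists (l, b, false).
  have [|l [b gE]] := gtail (seg y); first by rewrite eP.1 ey.
  by exists (l, b, true); move: gE; rewrite /g /= => ->; rewrite segK.
pose k y := xchoose (gsur y).
have gk : cancel k g by move=> y; apply/eqP/(xchooseP (gsur y)).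
have kg : cancel g k by move=> z; apply: ginj; rewrite gk.
pose parc z := k (arc (g z)).
have parcK : involutive parc by move=> z; rewrite /parc gk arcK kg.
have parc_neq z : parc z != z by rewrite -(can_eq kg) gk arc_neq.
exists (ArrowPres (isolated G) parcK parc_neq), g; split=> //; first by exists k.
- by move=> z; rewrite /= /parc gk.
- case=> [[l b] t]; rewrite arrow_turnE /quarter_turn eg /=.
  case: t; rewrite /g /= ?addbT ?addbF //=.
  by rewrite -seg_side -/(anti _); case: b; rewrite //= antiK.
- by move=> z; rewrite eg /at_head eqb_id.
Qed.

Lemma partial_dual_loc_equiv (G H : ribbon_graph) :
  partial_dual_orbit G H -> loc_equiv (medial G) (medial H).
Proof.
case=> P [A [[isoG [p [[q pq qp] pseg pside parc]]]]].
case=> isoH [r [[t rt tr] rseg rside rarc]].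
have [eG pT] := iso_quarter_turn pq qp pseg pside (at_head_orientation P).
have [eH rT] :=
  iso_quarter_turn rt tr rseg rside (at_head_orientation (partial_dual A)).
have newT z : new_end A (quarter_turn (@at_head P) z) =
              quarter_turn (@at_head (partial_dual A)) (new_end A z).
  by apply: (can_inj (@old_endK P A)); rewrite new_endK old_end_turn new_endK.
apply/loc_equiv_medialP; split; first by rewrite -isoG -isoH.
exists (@at_head P \o q), (@at_head (partial_dual A) \o t), (r \o new_end A \o q).
split=> // [|x|x].
- have bnew : bijective (new_end A).
    by exists (old_end A); [exact: new_endK|exact: old_endK].
  by apply: bij_comp; [apply: bij_comp bnew; exists t|exists p].
- by rewrite /= -{1}(qp x) -pT pq newT rT.
- rewrite /= -{1}(qp x) -parc pq -rarc; congr (r _).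
  by rewrite /= /dual_parc new_endK.
Qed.

(** The label set to dualise at consists of the edges whose tails are mapped to
   places where the quarter turn of [H] is along [side]. *)
Lemma loc_equiv_partial_dual (G H : ribbon_graph) :
  loc_equiv (medial G) (medial H) -> partial_dual_orbit G H.
Proof.
case/loc_equiv_medialP=> iso [e [e' [f [[eP e'P] fbij fT farc]]]].
have [P [g [isoP gbij garc gT eg]]] := oriented_presentation eP.
pose A := [set l | e' (f (g (l, false, arrow_tail)))].
exists P, A; split; split=> //.
- have [gseg gside] := turn_preserving_iso (at_head_orientation P) eP gT eg.
  by exists g.
- by rewrite -iso -isoP.
pose h (z : flag (ribbon_of (partial_dual A))) := f (g (old_end A z)).
have fgT z : f (g (quarter_turn (@at_head P) z)) = quarter_turn e' (f (g z)).
  by rewrite gT fT.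
have hT z : h (quarter_turn (@at_head (partial_dual A)) z) = quarter_turn e' (h z).
  by rewrite /h old_end_turn fgT.
(* Both sides change at each quarter turn, so they may be compared at one tail. *)
have fge l b t : e' (f (g (l, b, t))) = (l \in A) (+) t.
  have eT z := congr1 e' (fgT z).
  move: (eT (l, false, false)) (eT (l, false, true)) (eT (l, true, false)).
  rewrite !arrow_turnE /= !(edge_orientation_turn e'P) inE /arrow_tail => e1 e2 e3.
  by case: b t => [] []; rewrite ?e3 ?e2 ?e1; case: (e' _).
have eh z : e' (h z) = at_head z.
  case: z => [[l b] t]; rewrite /h (@old_endE P A) /=; case: ifP => lA.
    by rewrite arrow_turnE fge lA /at_head; case: t.
  by rewrite fge lA /at_head; case: t.
have [hseg hside] :=
  turn_preserving_iso (at_head_orientation (partial_dual A)) e'P hT eh.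
exists h; split=> //.
- apply: bij_comp fbij (bij_comp gbij _).
  by exists (new_end A); [apply: old_endK|apply: new_endK].
- by move=> z; rewrite /h /= /dual_parc new_endK -farc -garc.
Qed.

(** * Duality states *)

(** Around [v_e] the arrow tails and heads alternate, each tail being followed by
   its own head; this is the quarter turn of the presentation, so
   [mark] itself is the local equivalence. *)
Lemma duality_state_loc_equiv (G : ribbon_graph) (s : marked_state (medial G)) :
  duality_state s -> loc_equiv (medial (ribbon_of (state_pres s))) (medial G).
Proof.
move=> dual; have [o oP] := fin_all_exists dual.
have [k mk km] := medial_half_bij G.
apply/loc_equiv_medialP; split=> //.
(* The orientations witnessing flatness may differ from one medial vertex to
   another; glue them, using each one only at its own vertex. *)
pose e (x : flag G) := o (@vtx (medial G) (x, true)) (x, true).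
have eE x y : y \in [:: x; seg x; side x; seg (side x)] ->
    e y = o (@vtx (medial G) (x, true)) (y, true).
  by rewrite -incident_medial_halfE => /incident_medial_half ->.
have eP : edge_orientation e.
  split=> x; rewrite !(eE x) ?inE ?eqxx ?orbT //.
    exact: (edge_orientation_medial (o _)).1.
  exact: (edge_orientation_medial (o _)).2.
pose f (z : flag (ribbon_of (state_pres s))) := k (mark s z).
have fE z : mark s z = medial_half (f z) by rewrite /f km.
have fv z : z.1.1 = @vtx (medial G) (f z, true).
  by apply: incident_medial_half; rewrite -fE; apply: mark_incident.
have fbij : bijective f.
  apply: (@bij_comp _ _ _ k); first by exists (@medial_half G).
  by exists (unmark s); [apply: markK|apply: unmarkK].
have tailT v b : f (v, b, arrow_head) = quarter_turn e (f (v, b, arrow_tail)).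
  apply: (can_inj mk); rewrite -fE -oP fE rot_medial_half; congr medial_half.
  by rewrite /quarter_turn /e -(fv (v, b, arrow_tail)).
have halfT v b : quarter_turn e (quarter_turn e (f (v, b, arrow_tail))) =
                 f (v, ~~ b, arrow_tail).
  have ne := inj_eq (bij_inj fbij).
  apply: half_turn_mem => //;
    rewrite -?tailT ?ne ?xpair_eqE ?andbF //=; last first.
    by rewrite eqxx; case: b.
  rewrite -incident_medial_halfE -(fv (v, b, arrow_tail)) -fE.
  exact: (mark_incident s (v, ~~ b, arrow_tail)).
exists (@at_head _), e, f; split=> //.
- by split=> //; apply: at_head_orientation.
- case=> [[v b] []]; rewrite arrow_turnE ?addbT ?addbF /=; last exact: tailT.
  by rewrite -halfT -tailT.
- move=> z; apply: (can_inj mk); rewrite -opp_medial_half -!fE.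
  by rewrite /= /state_parc unmarkK.
Qed.

Theorem theorem4p24 (G : ribbon_graph) :
  (forall s : marked_state (medial G), duality_state s ->
     loc_equiv (medial (ribbon_of (state_pres s))) (medial G)) /\
  (forall H : ribbon_graph,
     partial_dual_orbit G H <-> loc_equiv (medial G) (medial H)).
Proof.
split; first exact: duality_state_loc_equiv.
by move=> H; split; [exact: partial_dual_loc_equiv|exact: loc_equiv_partial_dual].
Qed.
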